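(* Let $G$ be a discrete group and $f:G\to\mathbb{C}$ a function. Then $f\in\mathrm{A}_c(G)$ if and only if for every finite set $M\subseteq G$ and every $\varepsilon>0$, $f$ is the pointwise limit of an $(M,\varepsilon)$-jointly a.a. net $\{f_N\}_{N\in\mathcal{F}}$ of a.p. functions on $G$.
   Context: $\mathcal{F}$ is the directed set of finite subsets of $G$, ordered by inclusion ($N\ge M$ means $N\supseteq M$). For $f:G\to\mathbb{C}$ and $t\in G$ let $(ft)(x)=f(tx)$ and $(tf)(x)=f(xt)$. $f\in\mathrm{A}_{c}(G)$ (a.a. function) if every net $\{t_n\}$ in $G$ has a subnet $\{t_{n'}\}$ and some $\phi:G\to\mathbb{C}$ with $t_{n'}f\to\phi$ and $t_{n'}^{-1}\phi\to f$ pointwise, and likewise every net $\{t_n\}$ has a subnet and some $\phi$ with $ft_{n'}\to\phi$ and $\phi t_{n'}^{-1}\to f$ pointwise. (As $G$ is discrete, all functions are continuous.) A function $h:G\to\mathbb{C}$ is a.p. (von Neumann) if $Gh=\{th:t\in G\}$ and $hG=\{ht: t\in G\}$ are relatively compact in $(\mathbb{C}^G,\|\cdot\|_\infty)$. A set $B\subseteq G$ is syndetic in the discrete group $G$ if $G=K^{-1}B$ for some finite $K\subseteq G$. Given $M\in\mathcal{F}$ and $\varepsilon>0$, a net $\{f_N\}_{N\in\mathcal{F}}$ of a.a. functions on $G$ is $(M,\varepsilon)$-jointly a.a. (relative to $f$) if there is a set $B=B(M,\varepsilon)\subset G$ such that for all $N\ge M$: (i) $B=B^{-1}$; (ii) $B$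 is syndetic in $G$; (iii) if $b\in B$ then $\max_{s,t\in M}|f_N(sbt)-f_N(st)|<\varepsilon$; (iv) if $b_1,b_2\in B$ then $\max_{s,t\in M}|f_N(sb_1b_2t)-f_N(st)|<2\varepsilon$; (v) $\|f_N\|_\infty\le\|f\|_\infty$.
   Formalization: Condition (v) is read with ‖f‖_∞ finite, so a jointly a.a. net relative to f requires f bounded; if ‖f‖_∞ = ∞ were allowed, the claim would fail, e.g. for f(n) = 1/|e^{ian} − e^{ib}| on the integers (a/2π irrational, b not in aZ + 2πZ). *)

(* Defs.v *)
From HB Require Import structures.
From mathcomp Require Import all_boot all_order all_algebra finmap.
From mathcomp Require Import all_classical all_reals all_analysis.
From mathcomp Require Import complex.

Set Implicit Arguments.
Unset Strict Implicit.
Unset Printing Implicit Defensive.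

Import Order.TTheory GRing.Theory Num.Theory.
Import numFieldNormedType.Exports.
Import ComplexField.

Local Open Scope classical_set_scope.
Local Open Scope ring_scope.

(* MathComp-Analysis puts the norm topology and uniformity on every
   numClosedFieldType, but does not find them on the bare type R[i]; hence this
   packed version, whose elements are those of R[i]. *)
Definition Cplx (R : realType) : numClosedFieldType := R[i].

(* The modulus as an element of R: `|z| = (modulus z)%:C in R[i]. *)
Definition modulus (R : realType) (z : Cplx R) : R := Normc.normc z.

Record directedSet := DirectedSet {
  dcarrier :> Type;
  dle : dcarrier -> dcarrier -> Prop;
  dinhabited : inhabited dcarrier;
  dle_refl : forall x, dle x x;
  dle_trans : forall y x z, dle x y -> dle y z -> dle x z;
  dle_directed : forall x y, exists z, dle x z /\ dle y z }.

(* The filter of sets containing a tail {d | d0 <= d}: a net u : D -> T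
   converges to l exactly when u @ tails D --> l. *)
Definition tails (D : directedSet) : set_system D :=
  filter_from [set: D] (fun d0 => [set d | dle d0 d]).
Arguments tails : clear implicits.

(* Kelley's subnets: u \o h is a subnet of u : D -> T when h : D' -> D is
   eventually above each element of D; h need not be monotone. *)
Definition subnet_map (D D' : directedSet) (h : D' -> D) : Prop :=
  forall d0 : D, exists d0' : D', forall d' : D', dle d0' d' -> dle d0 (h d').

Section FiniteSubsets.
Variable G : choiceType.
Local Open Scope fset_scope.

Lemma fin_refl (M : {fset G}) : M `<=` M.
Proof. exact: fsubset_refl. Qed.

Lemma fin_trans (N M P : {fset G}) : M `<=` N -> N `<=` P -> M `<=` P.
Proof. exact: fsubset_trans. Qed.

Lemma fin_directed (M N : {fset G}) : exists P : {fset G}, M `<=` P /\ N `<=` P.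
Proof. by exists (M `|` N); rewrite fsubsetUl fsubsetUr. Qed.

Definition finite_subsets : directedSet :=
  @DirectedSet {fset G} (fun M N => M `<=` N)
    (inhabits fset0) fin_refl fin_trans fin_directed.

End FiniteSubsets.

Section AlmostAutomorphic.
Variables (R : realType) (G : groupType).
Implicit Types (f g h phi : G -> Cplx R) (t : G) (B : set G).

Definition pointwise_lim (D : directedSet) (u : D -> G -> Cplx R) phi : Prop :=
  forall x : G, (fun d => u d x) @ tails D --> phi x.

(* t f and f t respectively. *)
Definition transl t f : G -> Cplx R := fun x => f (x * t)%g.
Definition transr f t : G -> Cplx R := fun x => f (t * x)%g.

Definition almost_automorphic f : Prop :=
  (forall (D : directedSet) (t : D -> G),
     exists (D' : directedSet) (h : D' -> D) (phi : G -> Cplx R),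
       [/\ subnet_map h,
           pointwise_lim (fun d' => transl (t (h d')) f) phi &
           pointwise_lim (fun d' => transl (t (h d'))^-1%g phi) f]) /\
  (forall (D : directedSet) (t : D -> G),
     exists (D' : directedSet) (h : D' -> D) (phi : G -> Cplx R),
       [/\ subnet_map h,
           pointwise_lim (fun d' => transr f (t (h d'))) phi &
           pointwise_lim (fun d' => transr phi (t (h d'))^-1%g) f]).

Definition almost_periodic h : Prop :=
  precompact (range (fun t => transl t h) : set {uniform G -> Cplx R}) /\
  precompact (range (fun t => transr h t) : set {uniform G -> Cplx R}).

Definition syndetic B : Prop :=
  exists K : {fset G},
    [set: G] = [set x | exists k b, [/\ k \in K, B b & x = (k^-1 * b)%g]].

(* Equal to +oo when f is unbounded. *)
Definition supnorm f : \bar R := ereal_sup (range (fun x => (modulus (f x))%:E)).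

(* The norm of f in the last condition is a real number, i.e. f is bounded.
   With +oo allowed, every Bohr-continuous f would satisfy the right-hand side
   of the theorem, including unbounded ones such as n |-> 1 / |e^(ian) - e^(ib)|
   on the integers, with a/2pi irrational and b not in aZ + 2 pi Z; these are
   not almost automorphic. *)
Definition jointly_aa (M : {fset G}) (eps : R) f (F : {fset G} -> G -> Cplx R)
    : Prop :=
  (forall N : {fset G}, almost_automorphic (F N)) /\
  exists B : set G, forall N : {fset G}, (M `<=` N)%fset ->
    [/\ B = [set b^-1%g | b in B],
        syndetic B,
        forall b, B b -> forall s t, s \in M -> t \in M ->
          modulus (F N (s * b * t)%g - F N (s * t)%g) < eps,
        forall b1 b2, B b1 -> B b2 -> forall s t, s \in M -> t \in M ->
          modulus (F N (s * b1 * b2 * t)%g - F N (s * t)%g) < 2 * eps &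
        (supnorm f < +oo)%E /\ (supnorm (F N) <= supnorm f)%E].

End AlmostAutomorphic.

(* Main.v *)
Require Import Defs.
From HB Require Import structures.
From mathcomp Require Import all_boot all_order all_algebra finmap.
From mathcomp Require Import all_classical all_reals all_analysis.
From mathcomp Require Import complex.
From mathcomp Require Import ring lra.

Set Implicit Arguments.
Unset Strict Implicit.
Unset Printing Implicit Defensive.

Import Order.TTheory GRing.Theory Num.Theory.
Import numFieldNormedType.Exports.
Import ComplexField.

Local Open Scope classical_set_scope.
Local Open Scope ring_scope.

(** An almost automorphic function is a bounded function that is continuous for
    a precompact group topology on G, and such a function can be smoothed.

    From right to left, the limit f inherits from the approximants a symmetric
    syndetic set B with f(s b1 b2 t) close to f(st). For an ultrafilter on the
    index set of a net, almost all t_d lie in one translate k^-1 B; then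
    t_d^-1 t_d' lies in B B, and the iterated limit of f(x t_d^-1 t_d') is close
    to f(x) (bohr_almost_automorphic). The ultrafilter itself serves as
    the index set of the subnet.

    From left to right, put C(N,e) = {b | |f(sbt) - f(st)| < e for s, t in N}
    (aa_nbhs). Almost automorphy says that every sequence t of elements of G has
    indices n < m with t_n^-1 t_m in C(N,e) (aa_recurrence). A greedily chosen
    sequence then shows that C(N,e) is syndetic. A sequence of products shows
    that a^-1 b lies in C(N,e) for a and b in a finer C(M,d) (aa_nbhs_div). Thus
    the C(N,e) are the neighbourhoods of 1 in a precompact group topology
    (aa_topology_precompact), and precompactness makes conjugation
    equicontinuous (pn_conj).

    For each neighbourhood U of 1 there is a uniformly continuous F whose value
    at x lies in the convex hull of the values of f on xU (smoothing): average f
    over a finite net with the weights of a uniformly continuous kernel,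
    obtained from a pseudometric. Uniform continuity makes F almost periodic and
    almost automorphic; the convex hull property bounds F by the norm of f and
    lets one set B, which depends on M and eps alone, serve for all the
    approximants. Shrinking U as N grows gives pointwise convergence. On a
    finite group no U need make the error small, but there f is its own
    approximation. *)

(** * The modulus of a complex number *)

Section Modulus.
Variable R : realType.
Implicit Types x y z : Cplx R.

Lemma modulus_ge0 x : 0 <= modulus x.
Proof. by case: x => a b; exact: sqrtr_ge0. Qed.

Lemma modulus0 : modulus (0 : Cplx R) = 0.
Proof. exact: Normc.normc0. Qed.

Lemma le_modulusD x y : modulus (x + y) <= modulus x + modulus y.
Proof. exact: le_normcD. Qed.

Lemma modulusM x y : modulus (x * y) = modulus x * modulus y.
Proof. exact: Normc.normcM. Qed.

Lemma modulusN x : modulus (- x) = modulus x.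
Proof. exact: normcN. Qed.

Lemma modulusBC x y : modulus (x - y) = modulus (y - x).
Proof. by rewrite -modulusN opprB. Qed.

Lemma modulus_distD y x z : modulus (x - z) <= modulus (x - y) + modulus (y - z).
Proof. by rewrite -(subrKA y); exact: le_modulusD. Qed.

Lemma modulus_le_distD y x : modulus x <= modulus (x - y) + modulus y.
Proof. by have := modulus_distD y x 0; rewrite !subr0. Qed.

Lemma modulus_realE (a : R) : modulus (a%:C%C : Cplx R) = `|a|.
Proof. by rewrite /modulus /= expr0n /= addr0 sqrtr_sqr. Qed.

Lemma modulus_sum (I : Type) (s : seq I) (u : I -> Cplx R) :
  modulus (\sum_(i <- s) u i) <= \sum_(i <- s) modulus (u i).
Proof.
elim/big_ind2 : _ => [|x1 x2 y1 y2 h1 h2|//]; first by rewrite modulus0.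
by rewrite (le_trans (le_modulusD _ _))// lerD.
Qed.

Lemma cvg_modulusP (T : Type) (F : set_system T) (FF : Filter F)
    (u : T -> Cplx R) (l : Cplx R) :
  u @ F --> l <-> forall e : R, 0 < e -> \forall d \near F, modulus (l - u d) < e.
Proof.
split=> [/cvgrPdist_lt ul e e0|ul].
  have e0' : 0 < (e%:C%C : Cplx R) by rewrite ltcR.
  near=> d; rewrite -ltcR; near: d; exact: ul.
apply/cvgrPdist_lt => -[e e'] /=; rewrite ltcE /= => /andP[/eqP -> e0].
near=> d; rewrite -[Complex e 0]/(e%:C)%C.
rewrite (_ : `|l - u d| = (modulus (l - u d))%:C%C)// ltcR.
by near: d; exact: ul.
Unshelve. all: by end_near. Qed.

Lemma modulus_Re x : `|complex.Re x| <= modulus x.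
Proof.
by case: x => a b /=; rewrite /modulus /= -sqrtr_sqr ler_wsqrtr// lerDl sqr_ge0.
Qed.

Lemma modulus_Im x : `|complex.Im x| <= modulus x.
Proof.
by case: x => a b /=; rewrite /modulus /= -sqrtr_sqr ler_wsqrtr// lerDr sqr_ge0.
Qed.

Lemma le_modulus_ReIm x : modulus x <= `|complex.Re x| + `|complex.Im x|.
Proof.
case: x => a b; rewrite /modulus /= -[leRHS]ger0_norm ?addr_ge0// -sqrtr_sqr.
rewrite ler_wsqrtr// sqrrD !real_normK ?num_real// addrAC lerDl.
by rewrite mulrn_wge0 ?mulr_ge0.
Qed.

(** Compactness of a square: its image filter has a cluster point, and
    for an ultrafilter a cluster point is a limit. *)
Lemma ultra_bounded_lim (T : Type) (U : set_system T) (UU : UltraFilter U)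
    (u : T -> Cplx R) (K : R) :
  U [set d | modulus (u d) <= K] ->
  exists l, forall e : R, 0 < e -> U [set d | modulus (l - u d) < e].
Proof.
move=> UK; pose v d : R * R := (complex.Re (u d), complex.Im (u d)).
pose box := (`[(- K), K] `*` `[(- K), K] : set (R * R)).
have cbox : compact box by apply: compact_setX; exact: segment_compact.
have vbox : (v @ U) box.
  apply: (@filterS _ U _ _ (v @^-1` box) _ UK) => d /= uK.
  rewrite /box set_itvcc /= -!ler_norml.
  by rewrite (le_trans (modulus_Re _))// (le_trans (modulus_Im _)).
have [[a b] [_ ab]] := cbox _ (fmap_proper_filter v _) vbox.
exists (Complex a b) => e e0.
pose N : set T := [set d | ball (a, b) (e / 2) (v d)].
have UN : U N.
  have [//|UcN] := in_ultra_setVsetC N UU.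
  have [|w [/= cNw Bw]] := ab (~` ball (a, b) (e / 2)) (ball (a, b) (e / 2)) UcN.
    by apply: nbhsx_ballx; rewrite divr_gt0.
  by [].
apply: filterS UN => d -[/=]; rewrite /ball /= => Ha Hb.
rewrite (le_lt_trans (le_modulus_ReIm _))// (splitr e).
by rewrite ltrD//; [move: Ha|move: Hb]; case: (u d).
Qed.

End Modulus.

(** * Nets and ultrafilters *)

Section Nets.

Global Instance tails_filter (D : directedSet) : ProperFilter (tails D).
Proof.
have [d0] := dinhabited D.
apply: filter_from_proper; last by move=> d _; exists d; exact: dle_refl.
apply: filter_from_filter; first by exists d0.
move=> d1 d2 _ _; have [d [d1d d2d]] := dle_directed d1 d2.
by exists d => // d' dd'; split; exact: dle_trans dd'.
Qed.

Lemma near_subnet (D D' : directedSet) (h : D' -> D) (P : set D) :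
  subnet_map h -> (\forall d \near tails D, P d) ->
  \forall d' \near tails D', P (h d').
Proof.
move=> hs [d0 _ dP]; have [d0' hd0] := hs d0.
by exists d0' => // d' d0d'; apply: dP; exact: hd0.
Qed.

(** The points d of the members A of an ultrafilter V finer than the tails,
    ordered by reverse inclusion of the A, index a subnet along which whatever
    holds on a member of V holds eventually. *)
Section UltraSubnet.
Variables (D : directedSet) (V : set_system D).
Hypotheses (VU : UltraFilter V) (tV : tails D `<=` V).

Let index := {p : set D * D | V p.1 /\ p.1 p.2}.

Let index_le (p q : index) := (sval q).1 `<=` (sval p).1.

Let index_inhabited : inhabited index.
Proof.
have [d] := dinhabited D.
by constructor; exists (setT, d); split => //; exact: filterT.
Qed.

Let index_refl p : index_le p p. Proof. by []. Qed.

Let index_trans q p r : index_le p q -> index_le q r -> index_le p r.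
Proof. by move=> pq qr; exact: subset_trans qr pq. Qed.

Let index_directed p q : exists r, index_le p r /\ index_le q r.
Proof.
case: p q => [[A a] Aa] [[B b] Bb]; have [VA _] := Aa; have [VB _] := Bb.
have VAB : V (A `&` B) by exact: filterI.
have [d ABd] := filter_ex VAB.
by exists (exist _ (A `&` B, d) (conj VAB ABd)); split => x [].
Qed.

Definition ultra_index : directedSet :=
  DirectedSet index_inhabited index_refl index_trans index_directed.

Definition ultra_map (p : ultra_index) : D := (sval p).2.

Lemma near_ultra_map (P : set D) :
  V P -> \forall p \near tails ultra_index, P (ultra_map p).
Proof.
move=> VP; have [d Pd] := filter_ex VP.
exists (exist _ (P, d) (conj VP Pd)) => // q dq.
by have [_ qq] := svalP q; exact: dq.
Qed.

Lemma ultra_map_subnet : subnet_map ultra_map.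
Proof.
move=> d0; have : V [set d | dle d0 d] by apply: tV; exists d0.
by move/near_ultra_map => [d0' _ hd0]; exists d0'.
Qed.

End UltraSubnet.

Lemma ultra_fset (T : Type) (I : choiceType) (K : {fset I}) (V : set_system T)
    (A : set T) (P : I -> set T) :
  UltraFilter V -> V A -> (forall d, A d -> exists2 k, k \in K & P k d) ->
  exists2 k, k \in K & V (P k).
Proof.
move=> VU VA cover; apply: contrapT => /forall2NP nVP.
have : V (\bigcap_(i in [set` K]) (~` P i)).
  apply: filter_bigI => k kK.
  by have [VPk|//] := in_ultra_setVsetC (P k) VU; case: (nVP k) => [/(_ kK)|].
move=> /(filterI VA)/filter_ex[d [Ad dP]]; have [k kK Pkd] := cover d Ad.
exact: dP k kK Pkd.
Qed.

End Nets.

(** * A criterion for almost automorphy *)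

Section BohrCriterion.
Variables (R : realType) (G : groupType).
Implicit Types (f : G -> Cplx R).

Lemma syndeticP (B : set G) :
  syndetic B <-> exists K : {fset G}, forall x, exists2 k, k \in K & B (k * x)%g.
Proof.
split=> -[K KB]; exists K; first move=> x.
  have : [set x | exists k b, [/\ k \in K, B b & x = (k^-1 * b)%g]] x.
    by rewrite -KB.
  by case=> k [b [kK Bb ->]]; exists k => //; rewrite mulVKg.
apply/esym/seteqP; split=> // x _; have [k kK Bkx] := KB x.
by exists k, (k * x)%g; split => //; rewrite mulKg.
Qed.

Definition bounded_by f (K : R) := forall x, modulus (f x) <= K.

(** With act d x = x t_d and act' d x = x t_d^-1 this is one half of almost
    automorphy, and with left translations it is the other. The hypothesis is
    the iterated limit of f(x t_d^-1 t_d'), or of f(t_d' t_d^-1 x), in a form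
    that does not mention phi. *)
Lemma ultra_limit_aa f K (D : directedSet) (act act' : D -> G -> G) :
    bounded_by f K ->
    (forall (V : set_system D), UltraFilter V -> forall x e, 0 < e ->
       V [set d | V [set d' | modulus (f (act d' (act' d x)) - f x) < e]]) ->
  exists (D' : directedSet) (h : D' -> D) (phi : G -> Cplx R),
    [/\ subnet_map h,
        pointwise_lim (fun d x => f (act (h d) x)) phi &
        pointwise_lim (fun d x => phi (act' (h d) x)) f].
Proof.
move=> fK itlim; have [V [VU tV]] := ultraFilterLemma (tails_filter D).
have /choice[phi phiP] x : exists l, forall e : R, 0 < e ->
    V [set d | modulus (l - f (act d x)) < e].
  by apply: (@ultra_bounded_lim _ _ _ VU _ K); apply: filterE => d; exact: fK.
exists (ultra_index VU), (@ultra_map D V VU), phi; split.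
- exact: ultra_map_subnet tV.
- move=> x; apply/cvg_modulusP => e e0.
  exact: near_ultra_map (phiP x e e0).
- move=> x; apply/cvg_modulusP => e e0.
  apply: (@near_ultra_map D V VU [set d | modulus (f x - phi (act' d x)) < e]).
  have e20 : 0 < e / 2 by rewrite divr_gt0.
  apply: filterS (itlim V VU x _ e20) => d /= Vd.
  have [d' [/= fd' phid']] := filter_ex (filterI Vd (phiP (act' d x) _ e20)).
  rewrite modulusBC (le_lt_trans (modulus_distD (f (act d' (act' d x))) _ _))//.
  by rewrite (splitr e) ltrD.
Qed.

(** By syndeticity an ultrafilter puts all the k t_d in B for one k; then
    t_d^-1 t_d' = (k t_d)^-1 (k t_d') is a product of two elements of B. For
    left translations the same is done with the t_d^-1. *)
Lemma bohr_almost_automorphic f K :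
    bounded_by f K ->
    (forall x e, 0 < e -> exists B : set G,
       [/\ forall b, B b -> B b^-1%g, syndetic B &
           forall b1 b2, B b1 -> B b2 ->
             modulus (f (x * b1 * b2)%g - f x) < e /\
             modulus (f (b1 * b2 * x)%g - f x) < e]) ->
  almost_automorphic f.
Proof.
move=> fK fB; split=> D t.
- apply: (ultra_limit_aa (act := fun d x => (x * t d)%g)
    (act' := fun d x => (x * (t d)^-1)%g) fK) => V VU x e e0.
  have [B [BV /syndeticP[S BS] fB12]] := fB x e e0.
  have [k _ Vk] : exists2 k, k \in S & V [set d | B (k * t d)%g].
    by apply: (ultra_fset VU filterT) => d _; exact: BS.
  apply: filterS (Vk) => d /= Bd; apply: filterS Vk => d' /= Bd'.
  have := (fB12 _ _ (BV _ Bd) Bd').1.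
  by rewrite invgM -!mulgA mulKg.
- apply: (ultra_limit_aa (act := fun d x => (t d * x)%g)
    (act' := fun d x => ((t d)^-1 * x)%g) fK) => V VU x e e0.
  have [B [BV /syndeticP[S BS] fB12]] := fB x e e0.
  have [k _ Vk] : exists2 k, k \in S & V [set d | B (k * (t d)^-1)%g].
    by apply: (ultra_fset VU filterT) => d _; exact: BS.
  apply: filterS (Vk) => d /= Bd; apply: filterS Vk => d' /= Bd'.
  have := (fB12 _ _ (BV _ Bd') Bd).2.
  by rewrite invgM invgK -!mulgA mulKg.
Qed.

End BohrCriterion.

(** * Recurrence for almost automorphic functions *)

(** The sequences that witness recurrence are built greedily, each term under a
    condition on all the terms before it. *)
Lemma choice_from_past (T : Type) (P : seq T -> T -> Prop) :
  (forall l, exists x, P l x) ->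
  exists u : nat -> T, forall n, P (mkseq u n) (u n).
Proof.
move=> /choice[next nextP].
pose past n := iter n (fun l => rcons l (next l)) [::].
exists (next \o past) => n.
suff -> : mkseq (next \o past) n = past n by exact: nextP.
by elim: n => // n IH; rewrite mkseqS IH.
Qed.

Lemma filter_fset2 (T : Type) (F : set_system T) (FF : Filter F)
    (I : choiceType) (N : {fset I}) (P : I -> I -> set T) :
  (forall i j, i \in N -> j \in N -> F (P i j)) ->
  F [set x | forall i j, i \in N -> j \in N -> P i j x].
Proof.
move=> FP; have := @filter_bigI T _ (N `*` N)%fset (fun p => P p.1 p.2) F FF.
move=> /(_ _)/filterS; apply.
  by move=> x Px i j iN jN; apply: (Px (i, j)); rewrite /= inE /= iN.
by case=> i j; rewrite inE /= => /andP[iN jN]; exact: FP.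
Qed.

Section Recurrence.

Let nat_directedP (m n : nat) : exists p, (m <= p)%N /\ (n <= p)%N.
Proof. by exists (maxn m n); rewrite leq_maxl leq_maxr. Qed.

Definition nat_directed : directedSet :=
  DirectedSet (inhabits 0%N) leqnn (fun n m p => @leq_trans n m p) nat_directedP.

Variables (R : realType) (G : groupType) (f : G -> Cplx R).
Hypothesis aaf : almost_automorphic f.

(** If |f(t_n)| > n, no subnet of f(t_n) converges. *)
Lemma almost_automorphic_bounded : exists K, bounded_by f K.
Proof.
apply: contrapT => /forallNP unbdd.
have /choice[t tP] (n : nat) : exists x, n%:R < modulus (f x).
  by have /existsNP[x] := unbdd n%:R; move/negP; rewrite -ltNge; exists x.
have [D' [h [phi [hs hphi _]]]] := aaf.1 nat_directed t.
have /cvg_modulusP/(_ 1 ltr01) near1 := hphi 1%g.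
pose n0 := (Num.truncn (modulus (phi 1%g) + 1)).+1.
have large : \forall d \near tails D', (n0 <= h d)%N.
  apply: (near_subnet hs (P := fun n : nat_directed => (n0 <= n)%N)).
  by exists n0.
have [d [/= phid n0d]] := filter_ex (filterI near1 large).
have := tP (h d); apply/negP; rewrite -leNgt.
move: phid; rewrite /transl mul1g modulusBC => /ltW phid.
rewrite (le_trans (modulus_le_distD (phi 1%g) _))//.
rewrite (@le_trans _ _ n0%:R) ?ler_nat//.
rewrite (le_trans (lerD phid (lexx _)))// addrC.
exact/ltW/truncnS_gt.
Qed.

(** The translates t_n r for different r may need different subnets, so the
    elements r are treated one after the other, each time passing to a further
    subnet; the earlier conclusions survive. *)
Lemma aa_subnet_recurrence (t : nat -> G) (rs : seq G) :
  exists (D : directedSet) (h : D -> nat_directed),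
    subnet_map h /\
    forall r, r \in rs -> forall x e, 0 < e ->
      \forall d \near tails D, \forall d' \near tails D,
        modulus (f (x * (t (h d) * r)^-1 * (t (h d') * r))%g - f x) < e.
Proof.
elim: rs => [|r rs [D [h [hs hrs]]]].
  by exists nat_directed, id; split=> // n; exists n.
have [D' [h' [phi [hs' hphi phif]]]] := aaf.1 D (fun d => t (h d) * r)%g.
exists D', (h \o h'); split.
  move=> n; have [d0 hd0] := hs n; have [d1 hd1] := hs' d0.
  by exists d1 => d d1d; apply: hd0; exact: hd1.
move=> r'; rewrite inE => /predU1P[->|r'rs] x e e0.
  have e20 : 0 < e / 2 by rewrite divr_gt0.
  have /cvg_modulusP/(_ _ e20) := phif x; apply: filterS => d /=.
  rewrite /transl /= => fphi.
  have /cvg_modulusP/(_ _ e20) := hphi (x * (t (h (h' d)) * r)^-1)%g.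
  apply: filterS => d' /=; rewrite /transl => phid'.
  rewrite modulusBC (splitr e).
  exact: le_lt_trans (modulus_distD _ _ _) (ltrD fphi phid').
have := near_subnet hs' (hrs r' r'rs x e e0); apply: filterS => d.
exact: near_subnet hs'.
Qed.

Definition aa_nbhs (N : {fset G}) (e : R) : set G :=
  [set b | forall s t, s \in N -> t \in N ->
     modulus (f (s * b * t)%g - f (s * t)%g) < e].

(** Apply the iterated limit to the nets t_d r at the points sr:
    sr (t_d r)^-1 (t_d' r) = s t_d^-1 t_d' r. *)
Lemma aa_recurrence (t : nat -> G) (N : {fset G}) (e : R) : 0 < e ->
  exists n m, (n < m)%N /\ aa_nbhs N e ((t n)^-1 * t m)%g.
Proof.
move=> e0; have [D [h [hs hrec]]] := aa_subnet_recurrence t N.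
have : \forall d \near tails D, \forall d' \near tails D,
    aa_nbhs N e ((t (h d))^-1 * t (h d'))%g.
  have : \forall d \near tails D, forall s r, s \in N -> r \in N ->
      \forall d' \near tails D,
        modulus (f (s * ((t (h d))^-1 * t (h d')) * r)%g - f (s * r)%g) < e.
    apply: filter_fset2 => s r sN rN.
    have := hrec r rN (s * r)%g e e0; apply: filterS => d.
    by apply: filterS => d'; rewrite invgM !mulgA mulgK.
  by apply: filterS => d dP; exact: filter_fset2.
move=> /filter_ex[d dP].
have later : \forall d' \near tails D, (h d < h d')%N.
  apply: (near_subnet hs (P := fun n : nat_directed => (h d < n)%N)).
  by exists (h d).+1.
have [d' [Hd' hdd']] := filter_ex (filterI dP later).
by exists (h d), (h d').
Qed.

End Recurrence.

(** * Precompact group topologies *)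

Section PrecompactNbhs.
Variable G : groupType.

(** The neighbourhood filters of 1 for the precompact group topologies on G,
    Hausdorff or not: syndeticity of the neighbourhoods is total
    boundedness. *)
Record precompact_nbhs (N : set_system G) : Prop := PrecompactNbhs {
  pn_filter : Filter N;
  pn_one : forall U, N U -> U 1%g;
  pn_div : forall U, N U ->
    exists2 V, N V & forall a b, V a -> V b -> U (a^-1 * b)%g;
  pn_conj1 : forall g U, N U -> N [set x | U (g^-1 * x * g)%g];
  pn_syndetic : forall U, N U -> syndetic U }.

Variables (N : set_system G) (PN : precompact_nbhs N).

Let NF : Filter N := pn_filter PN.
#[local] Existing Instance NF.

Lemma pn_inv U : N U -> N [set x | U x^-1%g].
Proof.
move=> NU; have [V NV VU] := pn_div PN NU; apply: filterS (NV) => x Vx /=.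
by rewrite -[x^-1%g]mulg1; apply: VU => //; exact: pn_one NV.
Qed.

Lemma pn_mul U : N U ->
  exists2 V, N V & forall a b, V a -> V b -> U (a * b)%g.
Proof.
move=> NU; have [V NV VU] := pn_div PN NU.
exists (V `&` [set x | V x^-1%g]); first by apply: filterI => //; exact: pn_inv.
by move=> a b [Va Va'] [Vb _]; rewrite -[a]invgK; exact: VU.
Qed.

(** Conjugation is uniformly controlled: finitely many k and a small symmetric
    W cover G by sets k^-1 W, and conjugating by g amounts to conjugating by one
    of those k and then by an element of W. *)
Lemma pn_conj U : N U -> N [set x | forall g, U (g^-1 * x * g)%g].
Proof.
move=> NU; have [V NV VU] := pn_mul NU; have [W NW WV] := pn_mul NV.
have NS : N (W `&` [set x | U x /\ W x^-1%g]).
  by do 2 apply: filterI => //; exact: pn_inv.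
have /syndeticP[K KS] := pn_syndetic PN NS.
have : N (\bigcap_(k in [set` K]) [set x | W ((k^-1)^-1 * x * k^-1)%g]).
  by apply: filter_bigI => k kK; exact: (pn_conj1 PN (k^-1)%g NW).
apply: filterS => x Wx g; have [k kK [Wkg [_ Wkg']]] := KS g.
have -> : (g^-1 * x * g = (k * g)^-1 * ((k^-1)^-1 * x * k^-1) * (k * g))%g.
  by rewrite invgM invgK !mulgA mulgVK mulgVK.
apply: VU; first exact/WV/Wx.
by rewrite -[(k * g)%g]mulg1; apply: WV => //; exact: pn_one NW.
Qed.

End PrecompactNbhs.

(** * The topology of an almost automorphic function *)

Section AlmostAutomorphicTopology.
Variables (R : realType) (G : groupType) (f : G -> Cplx R).
Hypothesis aaf : almost_automorphic f.

Definition aa_topology : set_system G :=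
  filter_from [set p : {fset G} * R | 0 < p.2] (fun p => aa_nbhs f p.1 p.2).

Lemma aa_topology_nbhs N e : 0 < e -> aa_topology (aa_nbhs f N e).
Proof. by move=> e0; exists (N, e). Qed.

Lemma aa_nbhs_sub (M N : {fset G}) d e : (N `<=` M)%fset -> d <= e ->
  aa_nbhs f M d `<=` aa_nbhs f N e.
Proof.
move=> /fsubsetP NM de b bM s t sN tN.
by apply: lt_le_trans de; apply: bM; exact: NM.
Qed.

Let aa_filter : Filter aa_topology.
Proof.
apply: filter_from_filter; first by exists (fset0, 1) => /=.
move=> [M d] [N e] /= d0 e0; exists (M `|` N, Num.min d e)%fset => /=.
  by rewrite lt_min d0.
rewrite subsetI; split; apply: aa_nbhs_sub;
  by rewrite ?fsubsetUl ?fsubsetUr ?ge_min ?lexx ?orbT.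
Qed.

(** Suppose that a_m and b_m are counterexamples chosen for ever larger sets M_m
    and ever smaller d_m, and put t_m = b_0 ... b_(m-1) a_m. For n < m,
    t_n^-1 t_m = a_n^-1 b_n b_(n+1) ... b_(m-1) a_m.
    If M_m contains the words formed before, then the letters a_m, b_(m-1), ...,
    b_(n+1) can be deleted in this order at the cost of d_m + ... + d_(n+1).
    Hence f(s t_n^-1 t_m r) stays close to f(s a_n^-1 b_n r), and recurrence of
    the t_m contradicts the choice of a_n and b_n. *)
Lemma aa_nbhs_div N e : 0 < e -> exists M d, 0 < d /\
  forall a b, aa_nbhs f M d a -> aa_nbhs f M d b -> aa_nbhs f N e (a^-1 * b)%g.
Proof.
move=> e0; apply: contrapT => noMd.
pose e2 := e / 2; have e20 : 0 < e2 by rewrite divr_gt0.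
pose M (l : seq (G * G)) := (N `|`
  [fset (s * t.1^-1 * last 1%g (unzip2 l))%g | s in N, t in l])%fset.
pose d (n : nat) := e2 / 2 ^+ n.+1.
have d0 n : 0 < d n by rewrite divr_gt0 ?exprn_gt0.
(* A term of the sequence is the pair (t_m, q_m) with t_m = p a_m and
   q_m = p b_m, where p = q_(m-1) is the product of the earlier b_i. *)
pose P (l : seq (G * G)) (x : G * G) :=
  [/\ aa_nbhs f (M l) (d (size l)) ((last 1 (unzip2 l))^-1 * x.1)%g,
      aa_nbhs f (M l) (d (size l)) ((last 1 (unzip2 l))^-1 * x.2)%g &
      ~ aa_nbhs f N e (x.1^-1 * x.2)%g].
have Pex l : exists x, P l x.
  move/forallNP/(_ (M l))/forallNP/(_ (d (size l))) : noMd.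
  move=> /not_andP[//|/existsNP[a /existsNP[b]]] /not_implyP[Ma /not_implyP[Mb]].
  move=> Nab; set p := last 1%g (unzip2 l).
  exists (p * a, p * b)%g; rewrite /P /= -/p !mulKg; split=> //.
  by rewrite invgM -mulgA mulKg.
have [u uP] := choice_from_past Pex.
pose p m := last 1%g (unzip2 (mkseq u m)).
have pS m : p m.+1 = (u m).2 by rewrite /p mkseqS /unzip2 map_rcons last_rcons.
have inMl s m : s \in N -> s \in M (mkseq u m) by rewrite inE => ->.
have inMr s n m : (n < m)%N -> s \in N ->
    (s * (u n).1^-1 * p m)%g \in M (mkseq u m).
  move=> nm sN; rewrite inE; apply/orP; right; apply/imfset2P.
  exists s => //; exists (u n) => //=; apply/mapP; exists n => //.
  by rewrite mem_iota.
(* e2 - e2 / 2 ^+ m bounds the sum of the d k for k < m. *)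
have telescope n m s r : (n < m)%N -> s \in N -> r \in N ->
    modulus (f (s * (u n).1^-1 * p m * r)%g - f (s * (u n).1^-1 * (u n).2 * r)%g)
      <= e2 - e2 / 2 ^+ m.
  move=> nm sN rN; elim: m nm => // m IH; rewrite ltnS leq_eqVlt pS.
  move=> /predU1P[->|nm].
    rewrite subrr modulus0 subr_ge0 ler_pdivrMr ?exprn_gt0// ler_peMr ?(ltW e20)//.
    by rewrite exprn_ege1// ler1n.
  apply: (le_trans (modulus_distD (f (s * (u n).1^-1 * p m * r)%g) _ _)).
  have [_ + _] := uP m; rewrite size_mkseq -/(p m).
  move=> /(_ _ _ (inMr _ _ _ nm sN) (inMl _ _ rN)).
  rewrite mulgA mulgK => /ltW H; apply: (le_trans (lerD H (IH nm))).
  rewrite /d exprS; have := exprn_gt0 m (ltr0n R 2) => h2; rewrite le_eqVlt.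
  by apply/orP; left; apply/eqP; field; rewrite gt_eqF.
have [n [m [nm rec]]] := aa_recurrence aaf (fun n => (u n).1) N e20.
have [_ _] := uP n; apply => s r sN rN.
have [+ _ _] := uP m; rewrite size_mkseq -/(p m).
move=> /(_ _ _ (inMr _ _ _ nm sN) (inMl _ _ rN)); rewrite mulgA mulgK => H1.
have H2 := telescope n m s r nm sN rN; have H3 := rec s r sN rN.
rewrite mulgA in H3; rewrite mulgA.
rewrite modulusBC in H2; rewrite modulusBC in H1.
apply: (le_lt_trans (modulus_distD (f (s * (u n).1^-1 * p m * r)%g) _ _)).
have H4 := modulus_distD (f (s * (u n).1^-1 * (u m).1 * r)%g).
apply: (le_lt_trans (lerD H2 (H4 _ _))).
apply: (@lt_le_trans _ _ (e2 - e2 / 2 ^+ m + (d m + e2))).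
  by rewrite ler_ltD// ltrD.
have : d m <= e2 / 2 ^+ m.
  rewrite /d exprS invfM ler_pM2l// ler_piMl ?invr_ge0 ?exprn_ge0//.
  by rewrite invf_le1// ler1n.
rewrite /e2; lra.
Qed.

(** Otherwise a sequence could avoid all the t_n C(N,e) with n smaller than the
    current index. *)
Lemma aa_nbhs_syndetic N e : 0 < e -> syndetic (aa_nbhs f N e).
Proof.
move=> e0; apply/syndeticP; apply: contrapT => /forallNP nsynd.
have /choice_from_past[t tP] (l : seq G) :
    exists x, forall k, k \in l -> ~ aa_nbhs f N e (k^-1 * x)%g.
  have /existsNP[x xP] := nsynd [fset k^-1%g | k in l]%fset.
  exists x => k kl Nkx; apply: xP; exists k^-1%g => //.
  exact: in_imfset.
have [n [m [nm]]] := aa_recurrence aaf t N e0.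
by apply: tP; apply/mapP; exists n; rewrite ?mem_iota.
Qed.

Lemma aa_topology_precompact : precompact_nbhs aa_topology.
Proof.
split=> [//|U|U|g U|U] [[N e] /= e0 NU].
- by apply: NU => s t _ _; rewrite mulg1 subrr modulus0.
- have [M [d [d0 MN]]] := aa_nbhs_div N e0.
  by exists (aa_nbhs f M d) => [|a b Ma Mb]; [exists (M, d)|exact/NU/MN].
- pose M := ([fset (s * g^-1)%g | s in N] `|` [fset (g * t)%g | t in N])%fset.
  exists (M, e) => //= b bM; apply: NU => s t sN tN.
  have := bM (s * g^-1)%g (g * t)%g; rewrite -!mulgA mulKg; apply.
    by rewrite inE; apply/orP; left; apply/imfsetP; exists s.
  by rewrite inE; apply/orP; right; apply/imfsetP; exists t.
- have /syndeticP[K KN] := aa_nbhs_syndetic N e0.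
  apply/syndeticP; exists K => x; have [k kK Nkx] := KN x.
  by exists k => //; exact: NU.
Qed.

End AlmostAutomorphicTopology.

(** * Smoothing in a precompact group *)

(** The kernel is 1 - dist/eps cut off at 0, for the distance of a pseudometric
    whose uniformity is coarser than that of T and has E as an entourage. *)
Lemma uniform_kernel (R : realType) (T : uniformType) (E : set (T * T)) :
  entourage E -> exists k : T -> T -> R,
    [/\ forall y x, 0 <= k y x,
        forall y x, 0 < k y x -> E (y, x),
        entourage [set p | 1 / 2 <= k p.1 p.2] &
        forall e, 0 < e ->
          entourage [set p | forall y, `|k y p.1 - k y p.2| <= e]].
Proof.
move=> entE; pose T' : pseudoMetricType R := gauge.type entE.
have [eps eps0 epsE] : exists2 eps : R, 0 < eps &
    forall x y : T', ball x eps y -> E (x, y).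
  have : @entourage T' E by exists O => //= p [].
  rewrite -entourage_ballE => -[eps /= eps0 epsE].
  by exists eps => // x y xy; exact: epsE (x, y) xy.
have fin_edist (p : T' * T') : edist p \is a fin_num.
  apply/edist_finP; exists 2 => //.
  exact: countable_uniform.countable_uniform_bounded.
pose dist (y x : T') : R := fine (edist (y, x)).
have dist_ball (x y : T') r : 0 < r -> ball x r y -> dist x y <= r.
  by move=> r0 xy; rewrite -lee_fin fineK// edist_fin.
have entourageT' A : @entourage T' A -> @entourage T A.
  by move/(gauge.gauge_ent entE).
exists (fun y x => Num.max 0 (1 - dist y x / eps)); split.
- by move=> y x; rewrite le_max lexx.
- move=> y x; rewrite lt_max ltxx /= subr_gt0 ltr_pdivrMr// mul1r => yx.
  by apply/epsE/(@edist_lt_ball _ T' _ (y, x)); rewrite -lte_fin fineK in yx.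
- apply: entourageT'; rewrite -entourage_ballE.
  exists (eps / 2) => /= [|[y x] /= yx]; first by rewrite divr_gt0.
  have := dist_ball _ _ _ (divr_gt0 eps0 (ltr0n R 2)) yx.
  rewrite -ler_pdivrMl// mulrC => yx'; rewrite le_max; apply/orP; right.
  lra.
- move=> e e0; apply: entourageT'; rewrite -entourage_ballE.
  have ee0 : 0 < e * eps by rewrite mulr_gt0.
  exists (e * eps) => //= -[x x'] /= xx' y.
  have := dist_ball _ _ _ ee0 xx'.
  have tri (a b c : T') : dist a c <= dist a b + dist b c.
    by rewrite -lee_fin EFinD !fineK//; exact: edist_triangle.
  have sym (a b : T') : dist a b = dist b a by rewrite /dist edist_sym.
  rewrite -ler_pdivrMr// => dxx'.
  have H1 : dist y x / eps <= dist y x' / eps + dist x x' / eps.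
    by rewrite -mulrDl ler_pM2r ?invr_gt0// (sym x).
  have H2 : dist y x' / eps <= dist y x / eps + dist x x' / eps.
    by rewrite -mulrDl ler_pM2r ?invr_gt0.
  rewrite ler_norml /Num.max; case: ltP => ?; case: ltP => ?; lra.
Qed.

Section Smoothing.
Variables (R : realType) (G : groupType) (N : set_system G).
Hypothesis PN : precompact_nbhs N.

Let NF : Filter N := pn_filter PN.
#[local] Existing Instance NF.

(** The entourages (x, y) with x^-1 y in a neighbourhood of 1 form the left
    uniformity of the topology. *)
Lemma group_kernel U : N U -> exists k : G -> G -> R,
  [/\ forall y x, 0 <= k y x,
      forall y x, 0 < k y x -> U (y^-1 * x)%g,
      N [set v | forall y, 1 / 2 <= k y (y * v)%g] &
      forall e, 0 < e -> N [set v | forall y x, `|k y x - k y (x * v)%g| <= e]].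
Proof.
move=> NU.
pose left_ent := filter_from N (fun V => [set p : G * G | V (p.1^-1 * p.2)%g]).
have left_filter : Filter left_ent.
  apply: filter_from_filter; first by exists setT; exact: (@filterT _ N).
  by move=> V W NV NW; exists (V `&` W); first exact: (@filterI _ N).
have left_diag A : left_ent A -> diagonal `<=` A.
  move=> [V NV VA] -[a b] /diagonalP ->; apply: VA => /=.
  by rewrite mulVg; exact: pn_one NV.
have left_inv A : left_ent A -> left_ent (A^-1)%relation.
  move=> [V NV VA]; exists [set x | V x^-1%g]; first exact: (pn_inv PN).
  by move=> [a b] /= Vab; apply: VA => /=; rewrite invgM invgK in Vab.
have left_split A : left_ent A -> exists2 B, left_ent B & (B \; B `<=` A)%relation.
  move=> [V NV VA]; have [W NW WV] := pn_mul PN NV.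
  exists [set p : G * G | W (p.1^-1 * p.2)%g]; first by exists W.
  move=> [a c] [b /= Wab Wbc]; apply: VA => /=.
  by have := WV _ _ Wab Wbc; rewrite /= mulgA mulgK.
pose T : uniformType := HB.pack G
  (isUniform.Build G left_filter left_diag left_inv left_split).
have [|k [k0 kU khalf kunif]] := @uniform_kernel R T [set p | U (p.1^-1 * p.2)%g].
  by exists U.
exists k; split => //.
- have [V NV VP] := khalf; apply: filterS NV => v Vv y.
  by apply: (VP (y, y * v)%g); rewrite /= mulKg.
- move=> e e0; have [V NV VP] := kunif e e0; apply: filterS NV => v Vv y x.
  by apply: (VP (x, x * v)%g); rewrite /= mulKg.
Qed.

Definition unif_cont (h : G -> Cplx R) :=
  forall e : R, 0 < e -> N [set v | forall x, modulus (h (x * v)%g - h x) <= e].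

(** F is the mean of f over a finite set, with weights k(y,x) normalised to have
    sum 1. Syndeticity provides the finite set: some y in it has k(y,x) >= 1/2,
    which bounds the normalising factor. The convex hull of the values of f on
    xU is described by the closed discs that contain them. *)
Lemma smoothing (f : G -> Cplx R) U : N U -> exists F : G -> Cplx R,
  unif_cont F /\
  forall x c r, (forall u, U u -> modulus (f (x * u)%g - c) <= r) ->
    modulus (F x - c) <= r.
Proof.
move=> NU; have [k [k0 kU khalf kunif]] := group_kernel (pn_inv PN NU).
have /syndeticP[K KP] := pn_syndetic PN khalf.
pose w z x := k z^-1%g x; pose S x := \sum_(z <- K) w z x.
pose p z x := w z x / S x.
have Shalf x : 1 / 2 <= S x.
  have [z zK wz] := KP x; move: (wz z^-1%g).
  rewrite mulKg => {}wz; apply: (le_trans wz).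
  by rewrite /S (big_fsetD1 z)//= lerDl sumr_ge0// => i _; exact: k0.
have S0 x : 0 < S x by apply: lt_le_trans (Shalf x); rewrite divr_gt0.
have p0 z x : 0 <= p z x by rewrite divr_ge0 ?k0// ltW.
have p1 x : \sum_(z <- K) p z x = 1 by rewrite /p -mulr_suml -/(S x) divff ?gt_eqF.
pose F x : Cplx R := \sum_(z <- K) (p z x)%:C%C * f z^-1%g.
exists F; split.
  pose B := \sum_(z <- K) modulus (f z^-1%g).
  have B0 : 0 <= B by rewrite sumr_ge0// => z _; exact: modulus_ge0.
  pose n : R := (#|` K|)%:R.
  have n0 : 0 <= n by rewrite ler0n.
  move=> e e0; pose eta := e / ((2 + 2 * n) * (B + 1)).
  have c0 : 0 < (2 + 2 * n) * (B + 1).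
    by apply: mulr_gt0; lra.
  have eta0 : 0 < eta by rewrite divr_gt0.
  apply: filterS (kunif _ eta0) => v kv x.
  have wv z : `|w z (x * v)%g - w z x| <= eta by rewrite distrC kv.
  have Sv : `|S x - S (x * v)%g| <= n * eta.
    rewrite /S -sumrB (le_trans (ler_norm_sum _ _ _))//.
    rewrite (@le_trans _ _ (\sum_(z <- K) eta))//.
      by apply: ler_sum => z _; rewrite distrC.
    by rewrite big_const_seq count_predT iter_addr_0 mulr_natl.
  have Sinv y : (S y)^-1 <= 2.
    by rewrite -[2]invrK lef_pV2 ?posrE ?invr_gt0// -div1r.
  have pz1 z : z \in K -> p z x <= 1.
    by move=> zK; rewrite -(p1 x) (big_fsetD1 z)//= lerDl sumr_ge0.
  have pv z : z \in K -> `|p z (x * v)%g - p z x| <= (2 + 2 * n) * eta.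
    move=> zK; have -> : p z (x * v)%g - p z x = ((w z (x * v)%g - w z x)
        + p z x * (S x - S (x * v)%g)) / S (x * v)%g.
      by rewrite /p; field; rewrite !gt_eqF.
    rewrite normrM [X in _ * X]ger0_norm ?invr_ge0 ?(ltW (S0 _))//.
    have -> : (2 + 2 * n) * eta = (eta + n * eta) * 2 by ring.
    apply: ler_pM => //; first by rewrite invr_ge0 ltW.
    rewrite (le_trans (ler_normD _ _))// lerD//.
    rewrite normrM ger0_norm// (le_trans _ Sv)// ler_piMl//.
    exact: pz1.
  have -> : F (x * v)%g - F x =
      \sum_(z <- K) (p z (x * v)%g - p z x)%:C%C * f z^-1%g.
    by rewrite -sumrB; apply: eq_bigr => z _; rewrite rmorphB mulrBl.
  apply: (le_trans (modulus_sum _ _)).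
  apply: (@le_trans _ _ (\sum_(z <- K) (2 + 2 * n) * eta * modulus (f z^-1%g))).
    rewrite big_seq [leRHS]big_seq; apply: ler_sum => z zK.
    rewrite modulusM ler_wpM2r ?modulus_ge0//.
    by rewrite modulus_realE pv.
  rewrite -mulr_sumr -/B /eta.
  have -> : (2 + 2 * n) * (e / ((2 + 2 * n) * (B + 1))) * B = e * (B / (B + 1)).
    by field; rewrite !gt_eqF//; lra.
  by rewrite -[leRHS]mulr1 ler_pM2l// ler_pdivrMr ?mul1r; lra.
move=> x c r fr.
have -> : F x - c = \sum_(z <- K) (p z x)%:C%C * (f z^-1%g - c).
  transitivity (F x - (\sum_(z <- K) p z x)%:C%C * c); first by rewrite p1 mul1r.
  rewrite rmorph_sum mulr_suml -sumrB.
  by apply: eq_bigr => z _; rewrite mulrBr.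
apply: (le_trans (modulus_sum _ _)).
apply: (@le_trans _ _ (\sum_(z <- K) p z x * r)); last first.
  by rewrite -mulr_suml p1 mul1r.
apply: ler_sum => z _; rewrite modulusM modulus_realE ger0_norm//.
have [->|pz0] := eqVneq (p z x) 0; first by rewrite !mul0r.
rewrite ler_wpM2l//; have : 0 < k z^-1%g x.
  rewrite lt_neqAle k0 andbT eq_sym; apply: contra pz0 => /eqP wz0.
  by rewrite /p /w wz0 mul0r.
by move=> /kU /= /fr; rewrite invgM !mulgA mulgV mul1g invgK.
Qed.

End Smoothing.

(** * Uniformly continuous functions are almost periodic *)

Section AlmostPeriodic.
Variables (R : realType) (G : groupType).

Lemma uniform_nbhs_modulus (h : {uniform G -> Cplx R})
    (P : set {uniform G -> Cplx R}) :
  nbhs h P <->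
  exists2 e : R, 0 < e & [set g | forall x, modulus (h x - g x) < e] `<=` P.
Proof.
split=> [/uniform_nbhs[E [+ EP]]|[e e0 eP]].
  rewrite -entourage_ballE => -[[e e'] /=]; rewrite ltcE /= => /andP[/eqP -> e0] eE.
  exists e => // g hg; apply: EP => x _; apply: eE => /=.
  change (`|h x - g x| < (e%:C%C : Cplx R)).
  by rewrite (_ : `|h x - g x| = (modulus (h x - g x))%:C%C)// ltcR.
apply/uniform_nbhs; exists [set p | modulus (p.1 - p.2) < e]; split; last first.
  by move=> g hg; apply: eP => x; exact: hg.
rewrite -entourage_ballE; exists (e%:C%C : Cplx R) => [|[a b] /=].
  by rewrite /= ltcR.
by rewrite -ltcR.
Qed.

(** An ultrafilter on the closure of A has a pointwise limit, since it contains
    sets of uniformly small diameter; the same sets show that the convergence is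
    uniform. *)
Lemma totally_bounded_precompact (I : choiceType) (A : set {uniform G -> Cplx R}) :
  (forall e : R, 0 < e -> exists (K : {fset I}) (c : I -> G -> Cplx R),
     forall g, A g -> exists2 k, k \in K & forall x, modulus (c k x - g x) <= e) ->
  precompact A.
Proof.
move=> tbA; rewrite precompactE compact_ultra => U UU UA.
have near_center (e : R) : 0 < e ->
    exists c : G -> Cplx R, U [set g | forall x, modulus (c x - g x) < e].
  move=> e0; have e30 : 0 < e / 3 by rewrite divr_gt0.
  have [K [c cA]] := tbA _ e30.
  have [|k _ Uk] := @ultra_fset _ _ K U _ (fun k => [set g |
      forall x, modulus (c k x - g x) < e]) UU UA; last by exists (c k).
  move=> g Ag; have [|g' [Ag' gg']] :=
    Ag [set g' | forall x, modulus (g x - g' x) < e / 3].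
    by apply/uniform_nbhs_modulus; exists (e / 3).
  have [k kK cg'] := cA g' Ag'; exists k => // x.
  apply: (le_lt_trans (modulus_distD (g' x) _ _)).
  have := cg' x; have := gg' x; rewrite modulusBC; lra.
have /choice[phi phiP] x : exists l, forall e : R, 0 < e ->
    U [set g | modulus (l - g x) < e].
  have [c Uc] := near_center 1 ltr01.
  apply: (@ultra_bounded_lim _ _ _ UU _ (modulus (c x) + 1)).
  apply: filterS Uc => g /(_ x); rewrite modulusBC => /ltW cg.
  by rewrite /= (le_trans (modulus_le_distD (c x) _))// addrC lerD2l.
have Uphi : U --> (phi : {uniform G -> Cplx R}).
  move=> P /uniform_nbhs_modulus[e e0 eP].
  have e30 : 0 < e / 3 by rewrite divr_gt0.
  have [c Uc] := near_center _ e30; apply: filterS (Uc) => g cg; apply: eP => x.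
  have [g' [/= phig' cg']] := filter_ex (filterI (phiP x _ e30) Uc).
  apply: (le_lt_trans (modulus_distD (g' x) _ _)).
  apply: (le_lt_trans (lerD (lexx _) (modulus_distD (c x) _ _))).
  have := cg x; have := cg' x; rewrite modulusBC; lra.
exists phi; split => //.
by apply: closed_closure => P /Uphi UP; exact: filter_ex (filterI UA UP).
Qed.

Variables (N : set_system G) (PN : precompact_nbhs N).

Let NF : Filter N := pn_filter PN.
#[local] Existing Instance NF.

(** Right translates are close for arguments t, t' with t^-1 t' small; left
    translates need t^-1 t' small together with its conjugates. *)
Lemma unif_cont_almost_periodic (h : G -> Cplx R) :
  unif_cont N h -> almost_periodic h.
Proof.
move=> uh; split; apply: (@totally_bounded_precompact G) => e e0.
- have /syndeticP[K KP] := pn_syndetic PN (uh e e0).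
  exists K, (fun k => transl k^-1%g h) => _ [t _ <-]; have [k kK Vkt] := KP t.
  exists k => // x; rewrite modulusBC /transl.
  by have := Vkt (x * k^-1)%g; rewrite mulgA mulgVK.
- have /syndeticP[K KP] := pn_syndetic PN (pn_conj PN (uh e e0)).
  exists K, (fun k => transr h k^-1%g) => _ [t _ <-]; have [k kK Vkt] := KP t.
  exists k => // x; rewrite modulusBC /transr.
  have := Vkt x (k^-1 * x)%g; rewrite !mulgA.
  by rewrite mulgK mulVg mul1g.
Qed.

(** A neighbourhood V all of whose conjugates move h by at most e/3 meets the
    criterion. *)
Lemma unif_cont_almost_automorphic (h : G -> Cplx R) K :
  bounded_by h K -> unif_cont N h -> almost_automorphic h.
Proof.
move=> hK uh; apply: (bohr_almost_automorphic hK) => x e e0.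
have e30 : 0 < e / 3 by rewrite divr_gt0.
pose V := [set v | forall g, [set v | forall x, modulus (h (x * v)%g - h x) <= e / 3]
  (g^-1 * v * g)%g].
have NV : N V by exact: (pn_conj PN (uh _ e30)).
have hV b y z : V b -> modulus (h (y * b * z)%g - h (y * z)%g) <= e / 3.
  by move=> /(_ z (y * z)%g); rewrite !mulgA mulgK.
exists (V `&` [set v | V v^-1%g]); split.
- by move=> b [Vb Vb']; split => //=; rewrite invgK.
- by apply: (pn_syndetic PN); apply: filterI => //; exact: (pn_inv PN).
- move=> b1 b2 [Vb1 _] [Vb2 _]; split.
    apply: (le_lt_trans (modulus_distD (h (x * b1)%g) _ _)).
    have := hV b2 (x * b1)%g 1%g Vb2; have := hV b1 x 1%g Vb1.
    rewrite !mulg1; lra.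
  apply: (le_lt_trans (modulus_distD (h (b1 * x)%g) _ _)).
  have := hV b2 b1 x Vb2; have := hV b1 1%g x Vb1.
  rewrite !mul1g; lra.
Qed.

End AlmostPeriodic.

(** * Joint approximation *)

Section JointApproximation.
Variables (R : realType) (G : groupType).
Implicit Types (f : G -> Cplx R).

Lemma bounded_supnorm f K : bounded_by f K -> (supnorm f <= K%:E)%E.
Proof. by move=> fK; apply: ge_ereal_sup => _ [x _ <-]; rewrite lee_fin. Qed.

Lemma supnorm_bounded f :
  (supnorm f < +oo)%E -> bounded_by f (fine (supnorm f)).
Proof.
move=> f_lty x; have fx : ((modulus (f x))%:E <= supnorm f)%E.
  by apply: ereal_sup_ubound; exists x.
rewrite -lee_fin fineK// ge0_fin_numE// (le_trans _ fx)// lee_fin.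
exact: modulus_ge0.
Qed.

Lemma pointwise_lim_modulus_le (F : {fset G} -> G -> Cplx R) f M y z r :
  pointwise_lim (D := finite_subsets G) F f ->
  (forall N : {fset G}, (M `<=` N)%fset -> modulus (F N y - F N z) < r) ->
  modulus (f y - f z) <= r.
Proof.
move=> Ff Fr; apply/ler_addgt0Pr => e e0.
have e20 : 0 < e / 2 by rewrite divr_gt0.
have /cvg_modulusP/(_ _ e20) Fy := Ff y.
have /cvg_modulusP/(_ _ e20) Fz := Ff z.
have MF : tails (finite_subsets G) [set N | (M `<=` N)%fset] by exists M.
have [N [[/= Ny Nz] MN]] := filter_ex (filterI (filterI Fy Fz) MF).
apply: (le_trans (modulus_distD (F N y) _ _)).
apply: (le_trans (lerD (lexx _) (modulus_distD (F N z) _ _))).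
have := Fr N MN; rewrite (modulusBC _ (f z)); lra.
Qed.

(** In the limit, the inequality for two factors b1 and b2 gives the criterion. *)
Lemma joint_approximation_aa f :
  (forall (M : {fset G}) (eps : R), 0 < eps ->
     exists F : {fset G} -> G -> Cplx R,
       jointly_aa M eps f F /\ pointwise_lim (D := finite_subsets G) F f) ->
  almost_automorphic f.
Proof.
move=> approx.
have f_lty : (supnorm f < +oo)%E.
  have [F [[_ [B BF]] _]] := approx fset0 1 ltr01.
  by have [_ _ _ _ []] := BF _ (fsubset_refl _).
apply: (bohr_almost_automorphic (supnorm_bounded f_lty)) => x e e0.
have e30 : 0 < e / 3 by rewrite divr_gt0.
have [F [[_ [B BF]] Ff]] := approx [fset x; 1%g]%fset _ e30; exists B.
have [BV Bsynd _ _ _] := BF _ (fsubset_refl _).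
have xM : x \in [fset x; 1%g]%fset by rewrite !inE eqxx.
have M1 : 1%g \in [fset x; 1%g]%fset by rewrite !inE eqxx orbT.
split=> //; first by move=> b Bb; rewrite BV; exists b.
move=> b1 b2 Bb1 Bb2.
have lim_le s t : s \in [fset x; 1%g]%fset -> t \in [fset x; 1%g]%fset ->
    modulus (f (s * b1 * b2 * t)%g - f (s * t)%g) < e.
  move=> sM tM; apply: (@le_lt_trans _ _ (2 * (e / 3))); last by lra.
  apply: (pointwise_lim_modulus_le Ff) => N MN.
  by have [_ _ _ B12 _] := BF N MN; exact: B12.
split; first by have := lim_le x 1%g xM M1; rewrite !mulg1.
by have := lim_le 1%g x M1 xM; rewrite !mul1g.
Qed.

(** On a finite group B = {1} is syndetic. *)
Lemma finite_joint_approximation f (M : {fset G}) (eps : R) :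
  finite_set [set: G] -> almost_automorphic f -> 0 < eps ->
  almost_periodic f /\ jointly_aa M eps f (fun=> f).
Proof.
move=> /finite_fsetP[K GK] aaf eps0.
have inK x : x \in K by have : [set` K] x by rewrite -GK.
split.
  split; apply: (@totally_bounded_precompact _ _ G) => e e0.
    exists K, (fun t => transl t f) => _ [t _ <-]; exists t => // x.
    by rewrite subrr modulus0 ltW.
  exists K, (fun t => transr f t) => _ [t _ <-]; exists t => // x.
  by rewrite subrr modulus0 ltW.
split=> //; exists [set 1%g] => N _; split.
- by rewrite image_set1 invg1.
- by apply/syndeticP; exists K => x; exists x^-1%g => //=; rewrite mulVg.
- by move=> _ -> s t _ _; rewrite mulg1 subrr modulus0.
- by move=> _ _ -> -> s t _ _; rewrite !mulg1 subrr modulus0 mulr_gt0.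
- split => //; have [k fk] := almost_automorphic_bounded aaf.
  by rewrite (le_lt_trans (bounded_supnorm fk)) ?ltry.
Qed.

(** With V V inside W and W W inside C(M,eps/3), the set B is the symmetric part
    of V. For b1 and b2 in V and u in U, s b1 b2 t u = s b1 b2 (t u t^-1) t, so
    f is within eps/3 of f(st) on s b1 b2 t U as soon as the conjugates of U lie
    in W; hence so is F at s b1 b2 t. Infinitely many points are needed for the
    error 1/(#|N| + 1) on N to tend to 0. *)
Lemma infinite_joint_approximation f (M : {fset G}) (eps : R) :
  infinite_set [set: G] -> almost_automorphic f -> 0 < eps ->
  exists F : {fset G} -> G -> Cplx R,
    [/\ forall N : {fset G}, almost_periodic (F N),
        jointly_aa M eps f F &
        pointwise_lim (D := finite_subsets G) F f].
Proof.
move=> Ginf aaf eps0; have PN := aa_topology_precompact aaf.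
have FT : Filter (aa_topology f) := pn_filter PN.
have eps30 : 0 < eps / 3 by rewrite divr_gt0.
have [W NW WM] := pn_mul PN (aa_topology_nbhs f M eps30).
have [V NV VW] := pn_mul PN NW.
pose err (N : {fset G}) : R := (#|` N|.+1%:R)^-1.
have NU N : aa_topology f ([set v | forall g, W (g^-1 * v * g)%g]
    `&` aa_nbhs f (N `|` [fset 1%g])%fset (err N)).
  apply: filterI; first exact: (pn_conj PN NW).
  by apply: aa_topology_nbhs; rewrite invr_gt0.
have /choice[F FP] N := smoothing PN f (NU N).
have f_lty : (supnorm f < +oo)%E.
  have [k fk] := almost_automorphic_bounded aaf.
  by rewrite (le_lt_trans (bounded_supnorm fk)) ?ltry.
have Fbound N : bounded_by (F N) (fine (supnorm f)).
  move=> x; rewrite -[F N x]subr0; apply: (FP N).2 => u _.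
  by rewrite subr0; exact: supnorm_bounded.
have Fnear N b1 b2 s t : V b1 -> V b2 -> s \in M -> t \in M ->
    modulus (F N (s * b1 * b2 * t)%g - f (s * t)%g) <= eps / 3.
  move=> Vb1 Vb2 sM tM; apply: (FP N).2 => u [Wu _].
  have := WM _ _ (VW _ _ Vb1 Vb2) (Wu t^-1%g) s t sM tM.
  by rewrite invgK !mulgA mulgVK => /ltW.
have V1 := pn_one PN NV.
have Fclose N b1 b2 s t : V b1 -> V b2 -> s \in M -> t \in M ->
    modulus (F N (s * b1 * b2 * t)%g - F N (s * t)%g) < eps.
  move=> Vb1 Vb2 sM tM; apply: (le_lt_trans (modulus_distD (f (s * t)%g) _ _)).
  have := Fnear N _ _ _ _ Vb1 Vb2 sM tM; have := Fnear N _ _ _ _ V1 V1 sM tM.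
  rewrite !mulg1 (modulusBC (f _)); lra.
exists F; split.
- by move=> N; exact: unif_cont_almost_periodic PN _ (FP N).1.
- split.
    move=> N; exact: (unif_cont_almost_automorphic PN (Fbound N) (FP N).1).
  exists (V `&` [set v | V v^-1%g]) => N _; split.
  + apply/seteqP; split=> [b [Vb Vb']|_ [b [Vb Vb'] <-]].
      by exists b^-1%g; rewrite ?invgK//; split => //=; rewrite invgK.
    by split => //=; rewrite invgK.
  + by apply: (pn_syndetic PN); apply: filterI => //; exact: (pn_inv PN).
  + move=> b [Vb _] s t sM tM.
    by have := Fclose N b 1%g s t Vb V1 sM tM; rewrite mulg1.
  + move=> b1 b2 [Vb1 _] [Vb2 _] s t sM tM.
    by rewrite (lt_trans (Fclose N b1 b2 s t _ _ _ _))//; lra.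
  + split => //; have f_fin : supnorm f \is a fin_num.
      rewrite ge0_fin_numE// (@le_trans _ _ (modulus (f 1%g))%:E)//.
        by rewrite lee_fin modulus_ge0.
      by apply: ereal_sup_ubound; exists 1%g.
    by rewrite -(fineK f_fin); exact: bounded_supnorm.
- move=> x; apply/cvg_modulusP => e e0.
  have [N0 _ N0e] := infinite_set_fset (Num.truncn e^-1) Ginf.
  exists (N0 `|` [fset x])%fset => //= N N0N.
  have xN : x \in N by move/fsubsetP: N0N; apply; rewrite !inE eqxx orbT.
  have Ne : err N < e.
    rewrite /err invf_plt ?posrE// (lt_le_trans (truncnS_gt _))// ler_nat ltnS.
    rewrite (leq_trans N0e)// fsubset_leq_card// (fsubset_trans _ N0N)//.
    exact: fsubsetUl.
  rewrite modulusBC (le_lt_trans _ Ne)//; apply: (FP N).2 => u [_ Nu].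
  have := Nu x 1%g; rewrite !mulg1 => Nu'; apply/ltW/Nu'; rewrite !inE ?xN//.
  by rewrite eqxx orbT.
Qed.

End JointApproximation.

Theorem theoremC3 (R : realType) (G : groupType) (f : G -> Cplx R) :
  almost_automorphic f <->
  (forall (M : {fset G}) (eps : R), 0 < eps ->
     exists F : {fset G} -> G -> Cplx R,
       [/\ forall N : {fset G}, almost_periodic (F N),
           jointly_aa M eps f F &
           pointwise_lim (D := finite_subsets G) F f]).
Proof.
split=> [aaf M eps eps0|approx].
  have [Gfin|Ginf] := pselect (finite_set [set: G]).
    have [apf jaf] := finite_joint_approximation M Gfin aaf eps0.
    by exists (fun=> f); split => // x; exact: cvg_cst.
  exact: infinite_joint_approximation.
apply: joint_approximation_aa => M eps eps0.
by have [F [_ ? ?]] := approx M eps eps0; exists F.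
Qed.
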